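(* Let $N\in\{4,5,6,7,9,10,12\}$, let $\alpha\in\mathbb{Z}$ be an admissible parameter, and let $E_N$ be the (integral) Tate normal form with parameter $\alpha$, on which $P=(0,0)$ is a torsion point of order $N$ (see context). Let $G_n=\phi_n(P)$, $n\ge0$, be the sequence of numerators of the $x$-coordinates of the multiples of $P$. Put $\eta=\alpha^2-\alpha+1$, $\zeta=-\alpha^2+3\alpha-1$, $\lambda=(3\alpha^2-3\alpha+1)(\alpha-2\alpha^2)$, $\theta=2\alpha-2\alpha^2-1$. Then for all $n\ge0$: 1. $N=4$ ($\alpha\ne0$): $G_n=0$ if $n$ is odd, and $G_n=\alpha^{3n^2/4}$ if $n$ is even. 2. $N=5$ ($\alpha\neq0$): $G_n=0$ if $n\equiv1,4\ (5)$; otherwise $G_n=\alpha^{(4n^2-a)/5}$, where $a=0$ if $n\equiv0$, $a=1$ if $n\equiv2,3\ (5)$. 3. $N=6$ ($\alpha\neq-1,0$): $G_n=0$ if $n\equiv1,5\ (6)$; otherwise $G_n=\alpha^{(5n^2-a)/6}(\alpha+1)^{(2n^2+b)/3}$, where $a=0$ if $n\equiv0$, $2$ if $n\equiv2,4$, $3$ if $n\equiv3\ (6)$; $b=0$ if $n\equiv0,3$, $1$ if $n\equiv2,4\ (6)$. 4. $N=7$ ($\alpha\ne0,1$): $G_n=0$ if $n\equiv1,6\ (7)$; otherwise $G_n=\alpha^{(10n^2+a)/7}(\alpha-1)^{(6n^2-b)/7}$, where $(a,b)=(0,0)$ if $n\equiv0$, $(2,3)$ if $n\equiv2,5$, $(1,5)$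 if $n\equiv3,4\ (7)$. 5. $N=9$ ($\alpha\ne0,1$): $G_n=0$ if $n\equiv1,8\ (9)$; otherwise $G_n=\alpha^{(14n^2-a)/9}(\alpha-1)^{(8n^2-b)/9}\eta^{(2n^2+c)/3}$, where $a=0$ if $n\equiv0,3,6$, $2$ if $n\equiv2,7$, $-1$ if $n\equiv4,5\ (9)$; $b=0$ if $n\equiv0$, $5$ if $n\equiv2,7$, $9$ if $n\equiv3,6$, $11$ if $n\equiv4,5\ (9)$; $c=0$ if $n\equiv0,3,6$, $1$ if $n\equiv2,4,5,7\ (9)$. 6. $N=10$ ($\alpha\ne0,1$): $G_n=0$ if $n\equiv1,9\ (10)$; otherwise $G_n=\alpha^{(21n^2+a)/10}(\alpha-1)^{(9n^2-b)/10}(2\alpha-1)^{(4n^2-c)/5}\zeta^{(5n^2+d)/2}$, where $(a,b)=(0,0)$ if $n\equiv0$, $(6,6)$ if $n\equiv2,8$, $(1,11)$ if $n\equiv3,7$, $(4,14)$ if $n\equiv4,6$, $(5,15)$ if $n\equiv5\ (10)$; $c=0$ if $n\equiv0,5$, $1$ if $n\equiv2,3,7,8$, $-1$ if $n\equiv4,6\ (10)$; $d=0$ if $n\equiv0,2,4,6,8$, $1$ if $n\equiv3,5,7\ (10)$. 7. $N=12$ ($\alpha\ne0,1$): $G_n=0$ if $n\equiv1,11\ (12)$; otherwise $G_n=\varepsilon\,\alpha^{(n^2-a)/6}(\alpha-1)^{(59n^2+b)/12}(2\alpha-1)^{(n^2-c)/12}\lambda^{(3n^2+d)/4}\theta^{(2n^2+e)/3}$,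 where $\varepsilon=+1$ if $n\equiv0,2,3,9,10$, $-1$ if $n\equiv4,5,6,7,8\ (12)$; $(a,b)=(0,0)$ if $n\equiv0$, $(4,4)$ if $n\equiv2,10$, $(9,9)$ if $n\equiv3,9$, $(10,16)$ if $n\equiv4,8$, $(13,1)$ if $n\equiv5,7$, $(12,24)$ if $n\equiv6\ (12)$; $c=0$ if $n\equiv0,6$, $4$ if $n\equiv2,4,8,10$, $9$ if $n\equiv3,9$, $1$ if $n\equiv5,7\ (12)$; $d=0$ if $n$ is even, $1$ if $n\equiv3,5,7,9\ (12)$; $e=0$ if $n\equiv0,3,6,9$, $1$ if $n\equiv2,4,5,7,8,10\ (12)$.
   Context: $n\equiv r\ (N)$ means congruence modulo $N$. The curves $E_N$. For $N=4,5,6,7,9$, $E_N:\ y^2+(1-c)xy-by=x^3-bx^2$ with: $N=4$: $b=\alpha$, $c=0$; $N=5$: $b=c=\alpha$; $N=6$: $b=\alpha+\alpha^2$, $c=\alpha$; $N=7$: $b=\alpha^3-\alpha^2$, $c=\alpha^2-\alpha$; $N=9$: $c=\alpha^2(\alpha-1)$, $b=c(\alpha(\alpha-1)+1)$. (Here $b,c$ are unrelated to the exponents in the claim.) For $N=10,12$ an integral model is used: with $\beta=(2\alpha-1)(\alpha-1)$ and $\zeta,\lambda,\theta$ as in the claim, $E_{10}:\ y^2+(\zeta^2-\alpha\beta\zeta)xy-\alpha^3\beta\zeta^4y=x^3-\alpha^3\beta\zeta^2x^2$, $E_{12}:\ y^2+(\alpha-1)((\alpha-1)^3-\lambda)xy-(\alpha-1)^8\lambda\theta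 y=x^3-(\alpha-1)^4\lambda\theta x^2$. Admissible integers $\alpha$: $\alpha\ne0$ for $N=4,5$; $\alpha\neq-1,0$ for $N=6$; $\alpha\ne0,1$ for $N=7,9,10,12$. Division polynomials. For an elliptic curve $y^{2}+a_{1}xy+a_{3}y=x^{3}+a_{2}x^{2}+a_{4}x+a_{6}$ put $b_2=a_1^2+4a_2$, $b_4=2a_4+a_1a_3$, $b_6=a_3^2+4a_6$, $b_8=a_1^2a_6+4a_2a_6-a_1a_3a_4+a_2a_3^2-a_4^2$. Define $\psi_0=0$, $\psi_1=1$, $\psi_2=2y+a_1x+a_3$, $\psi_3=3x^4+b_2x^3+3b_4x^2+3b_6x+b_8$, $\psi_4=\psi_2\,(2x^6+b_2x^5+5b_4x^4+10b_6x^3+10b_8x^2+(b_2b_8-b_4b_6)x+(b_4b_8-b_6^2))$, and $\psi_{2n+1}=\psi_{n+2}\psi_n^3-\psi_{n-1}\psi_{n+1}^3$ $(n\ge2)$, $\psi_{2n}\psi_2=\psi_{n-1}^2\psi_n\psi_{n+2}-\psi_{n-2}\psi_n\psi_{n+1}^2$ $(n\ge3)$. Further $\phi_0=1$, $\phi_1=x$, and $\phi_n=x\psi_n^2-\psi_{n+1}\psi_{n-1}$ for $n\ge2$. If $\psi_n(P)\ne0$ then the $x$-coordinate of $[n]P$ is $\phi_n(P)/\psi_n(P)^2$. *)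

(* Defs.v *)
From HB Require Import structures.
From mathcomp Require Import all_boot all_order all_algebra.
From mathcomp Require Import zify ring.

Set Implicit Arguments.
Unset Strict Implicit.
Unset Printing Implicit Defensive.

Import GRing.Theory.
Local Open Scope ring_scope.

(* y^2 + a1 x y + a3 y = x^3 + a2 x^2 + a4 x + a6 over the integers *)
Record weierstrass := Weierstrass { a1 : int; a2 : int; a3 : int; a4 : int; a6 : int }.

(* Z[x][y]: the outer indeterminate is y, the inner one is x. *)
Notation Zxy := {poly {poly int}}.

Section DivisionPolynomials.

Variable W : weierstrass.

Definition b2 : int := a1 W ^+ 2 + 4 * a2 W.
Definition b4 : int := 2 * a4 W + a1 W * a3 W.
Definition b6 : int := a3 W ^+ 2 + 4 * a6 W.
Definition b8 : int :=
  a1 W ^+ 2 * a6 W + 4 * a2 W * a6 W - a1 W * a3 W * a4 W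
  + a2 W * a3 W ^+ 2 - a4 W ^+ 2.

Definition cst (c : int) : Zxy := c%:P%:P.
Definition varx : Zxy := 'X%:P.
Definition vary : Zxy := 'X.

Definition psi2 : Zxy := 2 * vary + cst (a1 W) * varx + cst (a3 W).
Definition psi3 : Zxy :=
  3 * varx ^+ 4 + cst b2 * varx ^+ 3 + 3 * cst b4 * varx ^+ 2
  + 3 * cst b6 * varx + cst b8.
Definition psi4_cofactor : Zxy :=
  2 * varx ^+ 6 + cst b2 * varx ^+ 5 + 5 * cst b4 * varx ^+ 4
  + 10 * cst b6 * varx ^+ 3 + 10 * cst b8 * varx ^+ 2
  + cst (b2 * b8 - b4 * b6) * varx + cst (b4 * b8 - b6 ^+ 2).

(* The even recursion determines f (2 n) because Z[x,y] is a domain and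
   psi2 != 0; see division_polynomials_unique and division_polynomials_exist. *)
Record division_polynomials (f : nat -> Zxy) : Prop := DivisionPolynomials {
  divpoly0 : f 0%N = 0;
  divpoly1 : f 1%N = 1;
  divpoly2 : f 2%N = psi2;
  divpoly3 : f 3%N = psi3;
  divpoly4 : f 4%N = psi2 * psi4_cofactor;
  divpoly_odd : forall n, (2 <= n)%N ->
    f (2 * n + 1)%N = f (n + 2)%N * f n ^+ 3 - f (n - 1)%N * f (n + 1)%N ^+ 3;
  divpoly_even : forall n, (3 <= n)%N ->
    f (2 * n)%N * f 2%N =
      f (n - 1)%N ^+ 2 * f n * f (n + 2)%N - f (n - 2)%N * f n * f (n + 1)%N ^+ 2
}.

Lemma psi2_neq0 : psi2 != 0.
Proof.
apply/eqP => /(congr1 (fun p : Zxy => p`_1)).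
have -> : psi2 = (2 : {poly int})%:P * 'X + (('X * (a1 W)%:P) + (a3 W)%:P)%:P.
  by rewrite /psi2 /cst /varx /vary !polyCD !polyCM; ring.
rewrite coefD coefCM coefX coefC coef0 /= mulr1 addr0.
by move/(congr1 (fun p : {poly int} => p`_0)); rewrite -polyCMn coefC coef0.
Qed.

Lemma division_polynomials_unique f g :
  division_polynomials f -> division_polynomials g -> f =1 g.
Proof.
move=> Hf Hg n; elim/ltn_ind: n => n IH.
case: (ltnP n 5) => [|n5].
  case: n {IH} => [|[|[|[|[|//]]]]] _.
  - by rewrite (divpoly0 Hf) (divpoly0 Hg).
  - by rewrite (divpoly1 Hf) (divpoly1 Hg).
  - by rewrite (divpoly2 Hf) (divpoly2 Hg).
  - by rewrite (divpoly3 Hf) (divpoly3 Hg).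
  - by rewrite (divpoly4 Hf) (divpoly4 Hg).
have [m [[En m2]|[En m3]]] : exists m,
    (n = 2 * m + 1 /\ 2 <= m)%N \/ (n = 2 * m /\ 3 <= m)%N.
  by exists n./2; lia.
- rewrite En (divpoly_odd Hf m2) (divpoly_odd Hg m2) !IH //; lia.
- apply: (mulIf psi2_neq0).
  rewrite -{1}(divpoly2 Hf) -(divpoly2 Hg) En.
  rewrite (divpoly_even Hf m3) (divpoly_even Hg m3) !IH //; lia.
Qed.

(* f n divided by psi2 for even n, and f n for odd n, as a list of the first
   values. *)
Let step (s : seq Zxy) (k : nat) : Zxy :=
  let p i := nth 0 s i in
  let m := k./2 in
  match k with
  | 0 => 0 | 1 => 1 | 2 => 1 | 3 => psi3 | 4 => psi4_cofactor
  | _ =>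
    if odd k then
      p (m + 2)%N * p m ^+ 3 * (if odd m then 1 else psi2 ^+ 4)
      - p (m - 1)%N * p (m + 1)%N ^+ 3 * (if odd m then psi2 ^+ 4 else 1)
    else p (m - 1)%N ^+ 2 * p m * p (m + 2)%N
         - p (m - 2)%N * p m * p (m + 1)%N ^+ 2
  end.

Let Fixpoint values (n : nat) : seq Zxy :=
  if n is k.+1 then rcons (values k) (step (values k) k) else [::].

Lemma division_polynomials_exist : {f | division_polynomials f}.
Proof.
have sz n : size (values n) = n by elim: n => //= n IH; rewrite size_rcons IH.
pose p n := step (values n) n.
have nthv n i : (i < n)%N -> nth 0 (values n) i = p i.
  elim: n => //= n IH; rewrite ltnS leq_eqVlt nth_rcons sz.
  by case/predU1P => [->|lt_in]; rewrite ?ltnn ?eqxx // lt_in IH.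
have p_odd m : (2 <= m)%N -> p (2 * m + 1)%N =
    p (m + 2)%N * p m ^+ 3 * (if odd m then 1 else psi2 ^+ 4)
    - p (m - 1)%N * p (m + 1)%N ^+ 3 * (if odd m then psi2 ^+ 4 else 1).
  move=> m2; rewrite {1}/p; set k := (2 * m + 1)%N.
  have [k' Ek] : exists k', k = k'.+4.+1 by exists (k - 5)%N; rewrite /k; lia.
  have -> : step (values k) k =
    if odd k then
      nth 0 (values k) (k./2 + 2) * nth 0 (values k) k./2 ^+ 3
        * (if odd k./2 then 1 else psi2 ^+ 4)
      - nth 0 (values k) (k./2 - 1) * nth 0 (values k) (k./2 + 1) ^+ 3
        * (if odd k./2 then psi2 ^+ 4 else 1)
    else nth 0 (values k) (k./2 - 1) ^+ 2 * nth 0 (values k) k./2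
           * nth 0 (values k) (k./2 + 2)
         - nth 0 (values k) (k./2 - 2) * nth 0 (values k) k./2
           * nth 0 (values k) (k./2 + 1) ^+ 2.
    by move: (values k) => s; rewrite Ek.
  have -> : odd k by rewrite /k; lia.
  have -> : k./2 = m by rewrite /k; lia.
  by rewrite !nthv //; rewrite /k; lia.
have p_even m : (3 <= m)%N -> p (2 * m)%N =
    p (m - 1)%N ^+ 2 * p m * p (m + 2)%N - p (m - 2)%N * p m * p (m + 1)%N ^+ 2.
  move=> m3; rewrite {1}/p; set k := (2 * m)%N.
  have [k' Ek] : exists k', k = k'.+4.+1 by exists (k - 5)%N; rewrite /k; lia.
  have -> : step (values k) k =
    if odd k then
      nth 0 (values k) (k./2 + 2) * nth 0 (values k) k./2 ^+ 3
        * (if odd k./2 then 1 else psi2 ^+ 4)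
      - nth 0 (values k) (k./2 - 1) * nth 0 (values k) (k./2 + 1) ^+ 3
        * (if odd k./2 then psi2 ^+ 4 else 1)
    else nth 0 (values k) (k./2 - 1) ^+ 2 * nth 0 (values k) k./2
           * nth 0 (values k) (k./2 + 2)
         - nth 0 (values k) (k./2 - 2) * nth 0 (values k) k./2
           * nth 0 (values k) (k./2 + 1) ^+ 2.
    by move: (values k) => s; rewrite Ek.
  have -> : odd k = false by rewrite /k; lia.
  have -> : k./2 = m by rewrite /k; lia.
  by rewrite !nthv //; rewrite /k; lia.
exists (fun n => p n * (if odd n then 1 else psi2)).
split.
- exact: mul0r.
- exact: mul1r.
- exact: mul1r.
- exact: mulr1.
- exact: mulrC.
- move=> m m2; rewrite p_odd //.
  have -> : odd (2 * m + 1) by lia.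
  have -> : odd (m + 2) = odd m by lia.
  have -> : odd (m - 1) = ~~ odd m by lia.
  have -> : odd (m + 1) = ~~ odd m by lia.
  by case: (odd m) => /=; ring.
- move=> m m3; rewrite p_even //.
  have -> : odd (2 * m) = false by lia.
  have -> : odd (m + 2) = odd m by lia.
  have -> : odd (m - 1) = ~~ odd m by lia.
  have -> : odd (m - 2) = odd m by lia.
  have -> : odd (m + 1) = ~~ odd m by lia.
  have -> : p 2%N = 1 by [].
  by case: (odd m) => /=; ring.
Qed.

Definition psi : nat -> Zxy := sval division_polynomials_exist.

Lemma psiP : division_polynomials psi.
Proof. exact: svalP division_polynomials_exist. Qed.

Definition phi (n : nat) : Zxy :=
  match n with
  | 0 => 1
  | 1 => varx
  | _ => varx * psi n ^+ 2 - psi (n + 1) * psi (n - 1)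
  end.

(* phi n evaluated at P = (0, 0) *)
Definition G (n : nat) : int := (phi n).[0].[0].

End DivisionPolynomials.

(* y^2 + (1 - c) x y - b y = x^3 - b x^2 *)
Definition tate (b c : int) : weierstrass := Weierstrass (1 - c) (- b) (- b) 0 0.

Section Curves.

Variable alpha : int.

Definition eta : int := alpha ^+ 2 - alpha + 1.
Definition zeta : int := - alpha ^+ 2 + 3 * alpha - 1.
Definition lambda : int :=
  (3 * alpha ^+ 2 - 3 * alpha + 1) * (alpha - 2 * alpha ^+ 2).
Definition theta : int := 2 * alpha - 2 * alpha ^+ 2 - 1.
Definition beta : int := (2 * alpha - 1) * (alpha - 1).

Definition E4 : weierstrass := tate alpha 0.
Definition E5 : weierstrass := tate alpha alpha.
Definition E6 : weierstrass := tate (alpha + alpha ^+ 2) alpha.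
Definition E7 : weierstrass := tate (alpha ^+ 3 - alpha ^+ 2) (alpha ^+ 2 - alpha).
Definition E9 : weierstrass :=
  let c := alpha ^+ 2 * (alpha - 1) in
  tate (c * (alpha * (alpha - 1) + 1)) c.
Definition E10 : weierstrass :=
  Weierstrass (zeta ^+ 2 - alpha * beta * zeta)
              (- (alpha ^+ 3 * beta * zeta ^+ 2))
              (- (alpha ^+ 3 * beta * zeta ^+ 4)) 0 0.
Definition E12 : weierstrass :=
  Weierstrass ((alpha - 1) * ((alpha - 1) ^+ 3 - lambda))
              (- ((alpha - 1) ^+ 4 * lambda * theta))
              (- ((alpha - 1) ^+ 8 * lambda * theta)) 0 0.

End Curves.

(* Main.v *)
Require Import Defs.
From mathcomp Require Import all_boot all_order all_algebra.
From mathcomp Require Import zify ring.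

Local Open Scope ring_scope.

Set Implicit Arguments.
Unset Strict Implicit.
Unset Printing Implicit Defensive.
Import GRing.Theory.

(** Let [h n] be the value of the [n]-th division polynomial at [P = (0, 0)]
    ([psi_at0]).  Since the abscissa of [P] is [0], the numerators are
    [G n = - h (n+1) h (n-1)] for [n >= 1], so everything follows from a closed
    form of [h].  The sequence [h] satisfies the odd and even duplication
    formulas of the division polynomials; these determine it from its first
    five terms because [h 2 = a3] is nonzero ([elliptic_rec_unique]).

    As [P] is a torsion point of order [N], Ward's theory of elliptic
    sequences predicts that [h (n + N) = A^n B h n] for two constants with
    [A^N = B^2].  On the curves at hand [A], [B] and the terms of one period
    are, up to sign, monomials in a few factors such as [alpha] and
    [alpha - 1].  The proof goes backwards: a table gives [A], [B] and one
    period, hence a candidate for [h].  The duplication formulas are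
    compatible with such a quasi-period, so it is enough to check them on one
    period ([elliptic_rec_periodic]).  Each check relates three monomials
    whose degrees in [alpha] can exceed [3000], but after division by their
    greatest common divisor ([holds_cancel_gcd]) only a few identities of small
    degree in [alpha] remain.  For [N = 7] the ones with three nonzero terms
    are, up to sign, [alpha - 1 = - 1 + alpha]; for [N = 12] the largest have
    degree [5] in the listed factors, such as [alpha^4 (2 alpha - 1)
    = (alpha - 1) lambda - alpha (2 alpha - 1)^2 theta].  By uniqueness the
    candidate is [h].

    Finally [G (n + N) = A^(2n + N) G n], whence
    [G (r + N k) = A^(k (2 r + N k)) G r] ([G_quadratic]).  As
    [k (2 r + N k) = (n^2 - r^2) / N] for [n = r + N k], the exponents of [G n]
    are quadratic in [n] up to a term that depends on [n] modulo [N] only. *)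

(** * Elliptic recursions with a quasi-period *)

Section EllipticRecursion.

Variable R : idomainType.
Implicit Types c h : nat -> R.

Definition odd_rec c m : Prop :=
  c (2 * m + 1)%N = c (m + 2)%N * c m ^+ 3 - c (m - 1)%N * c (m + 1)%N ^+ 3.

Definition even_rec c m : Prop :=
  c (2 * m)%N * c 2%N =
    c (m - 1)%N ^+ 2 * c m * c (m + 2)%N - c (m - 2)%N * c m * c (m + 1)%N ^+ 2.

Definition elliptic_rec c : Prop :=
  (forall m, (2 <= m)%N -> odd_rec c m) /\
  (forall m, (3 <= m)%N -> even_rec c m).

(** Every index above [4] is [2m + 1] or [2m] with terms of smaller index on
    the right of the recursion; in the even case [h 2] has to be cancelled. *)
Lemma elliptic_rec_unique c h :
  elliptic_rec c -> elliptic_rec h -> h 2%N != 0 ->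
  (forall i, (i < 5)%N -> h i = c i) -> h =1 c.
Proof.
move=> [co ce] [ho he] h2 hc0 n; elim/ltn_ind: n => n IH.
have [/hc0 //|n5] := ltnP n 5.
have [m [[En m2]|[En m3]]] : exists m,
    (n = 2 * m + 1 /\ 2 <= m)%N \/ (n = 2 * m /\ 3 <= m)%N.
  by exists n./2; lia.
- by rewrite En ho // co // !IH //; lia.
- by apply: (mulIf h2); rewrite En he // (hc0 2%N) // ce // !IH //; lia.
Qed.

Section QuasiPeriodic.

Variables (N : nat) (A B : R) (c : nat -> R).
Hypothesis AB : A ^+ N = B ^+ 2.
Hypothesis cN : forall n, c (n + N)%N = A ^+ n * B * c n.

(** Both products on the right pick up [A^(4m + 2) B^4], since
    [(m + 2) + 3 m = (m - 1) + 3 (m + 1)].  On the left the index moves by two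
    periods, which gives [A^(4m + 2 + N) B^2]; the two agree by
    [A^N = B^2]. *)
Lemma odd_rec_shift m : (2 <= m)%N -> odd_rec c m -> odd_rec c (m + N).
Proof.
rewrite /odd_rec => m2.
have -> : (2 * (m + N) + 1 = 2 * m + 1 + N + N)%N by lia.
have -> : (m + N + 2 = m + 2 + N)%N by lia.
have -> : (m + N - 1 = m - 1 + N)%N by lia.
have -> : (m + N + 1 = m + 1 + N)%N by lia.
rewrite !cN => ->.
have [k ->] : exists k, m = (k + 2)%N by exists (m - 2)%N; lia.
have -> : (k + 2 - 1 = k + 1)%N by lia.
have -> : A ^+ (2 * (k + 2) + 1 + N) = A ^+ (4 + 2 * k + 1) * A ^+ N.
  by rewrite -exprD; congr (_ ^+ _); lia.
rewrite AB !(mulnC 2) !exprD !exprM !exprD; ring.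
Qed.

Lemma even_rec_shift m : (3 <= m)%N -> even_rec c m -> even_rec c (m + N).
Proof.
rewrite /even_rec => m3.
have -> : (2 * (m + N) = 2 * m + N + N)%N by lia.
have -> : (m + N + 2 = m + 2 + N)%N by lia.
have -> : (m + N - 1 = m - 1 + N)%N by lia.
have -> : (m + N - 2 = m - 2 + N)%N by lia.
have -> : (m + N + 1 = m + 1 + N)%N by lia.
rewrite !cN => rec_m.
set C := A ^+ (2 * m + N) * B * (A ^+ (2 * m) * B).
rewrite (_ : _ * c 2%N = C * (c (2 * m)%N * c 2%N)) /C {C}; last by ring.
rewrite rec_m.
have [k ->] : exists k, m = (k + 2)%N by exists (m - 2)%N; lia.
have -> : (k + 2 - 1 = k + 1)%N by lia.
have -> : (k + 2 - 2 = k)%N by lia.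
have -> : A ^+ (2 * (k + 2) + N) = A ^+ (4 + 2 * k) * A ^+ N.
  by rewrite -exprD; congr (_ ^+ _); lia.
rewrite AB !(mulnC 2) !exprD !exprM !exprD; ring.
Qed.

Lemma elliptic_rec_periodic : (0 < N)%N ->
  (forall m, (m < N)%N -> odd_rec c (m + 2) /\ even_rec c (m + 3)) ->
  elliptic_rec c.
Proof.
move=> N0 base.
have all m : odd_rec c (m + 2) /\ even_rec c (m + 3).
  elim/ltn_ind: m => m IH; have [/base //|Nm] := ltnP m N.
  have [o e] : odd_rec c (m - N + 2) /\ even_rec c (m - N + 3).
    by apply: IH; lia.
  have -> : (m + 2 = m - N + 2 + N)%N by lia.
  have -> : (m + 3 = m - N + 3 + N)%N by lia.
  by split; [apply: odd_rec_shift | apply: even_rec_shift] => //; lia.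
split=> m m_ge; first by rewrite -(subnK m_ge); case: (all (m - 2)%N).
by rewrite -(subnK m_ge); case: (all (m - 3)%N).
Qed.

End QuasiPeriodic.

End EllipticRecursion.

(** * Signed monomials *)

Section Monomials.

(** Zero, or a sign ([true] for minus) with an exponent vector.  Missing
    trailing exponents count as [0]. *)
Definition monomial := option (bool * seq nat).

Fixpoint exp_mul (e f : seq nat) : seq nat :=
  match e, f with
  | i :: e', j :: f' => (i + j)%N :: exp_mul e' f'
  | [::], _ => f
  | _, [::] => e
  end.

Fixpoint exp_gcd (e f : seq nat) : seq nat :=
  if (e, f) is (i :: e', j :: f') then minn i j :: exp_gcd e' f' else [::].

Fixpoint exp_div (e f : seq nat) : seq nat :=
  if (e, f) is (i :: e', j :: f') then (i - j)%N :: exp_div e' f' else e.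

Definition mone : monomial := Some (false, [::]).

Definition mmul (x y : monomial) : monomial :=
  if (x, y) is (Some (s, e), Some (s', e')) then Some (s (+) s', exp_mul e e')
  else None.

Definition mopp (x : monomial) : monomial :=
  if x is Some (s, e) then Some (~~ s, e) else None.

Definition mexp (x : monomial) (n : nat) : monomial := iter n (mmul x) mone.

(** Zero is neutral: every monomial divides zero. *)
Definition mgcd (x y : monomial) : monomial :=
  match x, y with
  | Some (_, e), Some (_, f) => Some (false, exp_gcd e f)
  | None, _ => y
  | _, None => x
  end.

Definition mdiv (x y : monomial) : monomial :=
  if (x, y) is (Some (s, e), Some (s', f)) then Some (s (+) s', exp_div e f)
  else None.

Variables (R : comNzRingType) (p : seq R).

Fixpoint exp_val (q : seq R) (e : seq nat) : R :=
  if (q, e) is (a :: q', i :: e') then a ^+ i * exp_val q' e' else 1.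

Definition mval (x : monomial) : R :=
  if x is Some (s, e) then (-1) ^+ s * exp_val p e else 0.

Lemma exp_valM q e f : exp_val q (exp_mul e f) = exp_val q e * exp_val q f.
Proof.
elim: q e f => [|a q IH] [|i e] [|j f] /=; rewrite ?(mul1r, mulr1) //.
by rewrite IH exprD mulrACA.
Qed.

Lemma exp_valX q e K : exp_val q e ^+ K = exp_val q [seq (K * i)%N | i <- e].
Proof.
elim: q e => [|a q IH] [|i e] /=; rewrite ?expr1n //.
by rewrite exprMn IH -exprM mulnC.
Qed.

Lemma mvalM x y : mval (mmul x y) = mval x * mval y.
Proof.
rewrite /mmul; case: x y => [[s e]|] [[s' f]|] /=; rewrite ?(mul0r, mulr0) //.
by rewrite signr_addb exp_valM mulrACA.
Qed.

Lemma mval1 : mval mone = 1.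
Proof. by rewrite /= mul1r; case: p. Qed.

Lemma mvalN x : mval (mopp x) = - mval x.
Proof. by case: x => [[s e]|] /=; rewrite ?oppr0 // signrN mulNr. Qed.

Lemma mvalX x n : mval (mexp x n) = mval x ^+ n.
Proof. by elim: n => [|n IH]; rewrite ?mval1 // /mexp /= mvalM IH exprS. Qed.

(** A triple [(x, y, z)] stands for [x = y - z]. *)
Definition relation := (monomial * monomial * monomial)%type.

Definition holds (r : relation) : Prop :=
  let: (x, y, z) := r in mval x = mval y - mval z.

(** The test that the quotients multiply back to [r] spares a proof that [g] is
    a common divisor: if it failed, [r] would be kept. *)
Definition cancel_gcd (r : relation) : relation :=
  let: (x, y, z) := r in
  let g := mgcd x (mgcd y z) in
  let q u := mdiv u g in
  if all (fun u => mmul g (q u) == u) [:: x; y; z] then (q x, q y, q z) else r.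

Lemma holds_cancel_gcd r : holds (cancel_gcd r) -> holds r.
Proof.
case: r => [[x y] z]; rewrite /cancel_gcd; set g := mgcd x _.
case: ifP => // /and4P[/eqP Ex /eqP Ey /eqP Ez _]; rewrite /holds => E.
by rewrite -Ex -Ey -Ez !mvalM E mulrBr.
Qed.

Fixpoint all_hold (s : seq relation) : Prop :=
  if s is r :: s' then holds r /\ all_hold s' else True.

Lemma all_holdP s r : all_hold s -> r \in s -> holds r.
Proof.
elim: s => //= r' s IH [Hr' Hs]; rewrite inE => /predU1P[->|] //; exact: IH.
Qed.

End Monomials.

Arguments mmul : simpl never.
Arguments mexp : simpl never.

(** One period [c 0, ..., c (N - 1)] of a sequence of monomials with
    [c (n + N) = ratio^n * step * c n]. *)
Record torsion_table := TorsionTable {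
  terms : seq monomial;
  ratio : monomial;
  step : monomial
}.

Section MonomialSequence.

Variable T : torsion_table.
Local Notation t := (terms T).
Local Notation A := (ratio T).
Local Notation B := (step T).
Local Notation N := (size t).

(** Iterating the quasi-period [k] times from [r] gives the factor
    [A^(r k) A^(N k (k - 1) / 2) B^k], which is [A^(r k) B^(k^2)] as
    [A^N = B^2]. *)
Definition mterm (n : nat) : monomial :=
  let r := (n %% N)%N in let k := (n %/ N)%N in
  mmul (nth None t r) (mmul (mexp A (r * k)) (mexp B (k ^ 2))).

Definition odd_relation (m : nat) : relation :=
  (mterm (2 * m + 1), mmul (mterm (m + 2)) (mexp (mterm m) 3),
   mmul (mterm (m - 1)) (mexp (mterm (m + 1)) 3)).

Definition even_relation (m : nat) : relation :=
  (mmul (mterm (2 * m)) (mterm 2),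
   mmul (mmul (mexp (mterm (m - 1)) 2) (mterm m)) (mterm (m + 2)),
   mmul (mmul (mterm (m - 2)) (mterm m)) (mexp (mterm (m + 1)) 2)).

Definition period_relations : seq relation :=
  [seq odd_relation (m + 2) | m <- iota 0 N]
  ++ [seq even_relation (m + 3) | m <- iota 0 N].

(** Duplicates are removed, since a handful of relations remain once the
    common factors are gone. *)
Definition reduced_relations : seq relation :=
  undup (map cancel_gcd period_relations).

Arguments mterm : simpl never.

Variables (R : idomainType) (p : seq R).

Lemma mterm_shift : (0 < N)%N -> mexp A N = mexp B 2 ->
  forall n,
    mval p (mterm (n + N)) = mval p A ^+ n * mval p B * mval p (mterm n).
Proof.
move=> N0 /(congr1 (mval p)); rewrite !mvalX => AB n.
rewrite /mterm modnDr divnDr // divnn N0.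
set r := (n %% N)%N; set k := (n %/ N)%N.
have En : n = (N * k + r)%N by rewrite mulnC /k /r -divn_eq.
rewrite {}En !mvalM !mvalX (exprD _ (N * k)) (exprM _ N) AB.
have -> : (r * (k + true) = r * k + r)%N by rewrite addn1 mulnSr.
have -> : ((k + true) ^ 2 = k ^ 2 + (k + k) + 1)%N.
  by rewrite addn1 !expnS; lia.
rewrite !exprD (exprAC _ 2); ring.
Qed.

Theorem mterm_elliptic : (0 < N)%N -> mexp A N = mexp B 2 ->
  all_hold p reduced_relations -> elliptic_rec (fun n => mval p (mterm n)).
Proof.
move=> N0 AB rels.
apply: (@elliptic_rec_periodic _ N (mval p A) (mval p B)) => //.
- by rewrite -!mvalX AB.
- exact: mterm_shift.
have redP r : r \in period_relations -> holds p r.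
  move=> Hr; apply/holds_cancel_gcd/(all_holdP rels).
  by rewrite mem_undup; apply: map_f.
move=> m mN; have mI : m \in iota 0 N by rewrite mem_iota add0n mN.
split.
- have /redP : odd_relation (m + 2) \in period_relations.
    by rewrite mem_cat; apply/orP; left; apply/mapP; exists m.
  by rewrite /odd_rec -!mvalX -!mvalM.
- have /redP : even_relation (m + 3) \in period_relations.
    by rewrite mem_cat; apply/orP; right; apply/mapP; exists m.
  by rewrite /even_rec -!mvalX -!mvalM.
Qed.

End MonomialSequence.

(** * Division polynomials at the origin *)

Section CurveThroughOrigin.

Variable W : weierstrass.

Definition at0 (q : Zxy) : int := q.[0].[0].

Lemma at0D q r : at0 (q + r) = at0 q + at0 r.
Proof. by rewrite /at0 !hornerD. Qed.

Lemma at0N q : at0 (- q) = - at0 q.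
Proof. by rewrite /at0 !hornerN. Qed.

Lemma at0M q r : at0 (q * r) = at0 q * at0 r.
Proof. by rewrite /at0 !hornerM. Qed.

Lemma at0X q n : at0 (q ^+ n) = at0 q ^+ n.
Proof. by rewrite /at0 !horner_exp. Qed.

Lemma at0_cst c : at0 (cst c) = c.
Proof. by rewrite /at0 /cst !hornerC. Qed.

Lemma at0_varx : at0 varx = 0.
Proof. by rewrite /at0 /varx hornerC hornerX. Qed.

Lemma at0_vary : at0 vary = 0.
Proof. by rewrite /at0 /vary hornerX horner0. Qed.

Definition at0E :=
  (at0D, at0N, at0M, at0X, at0_cst, at0_varx, at0_vary, expr0n, mulr0, add0r).

Definition psi_at0 (n : nat) : int := at0 (psi W n).

Lemma psi_at0_elliptic : elliptic_rec psi_at0.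
Proof.
have P := psiP W; split=> m m_ge.
- by rewrite /odd_rec /psi_at0 (divpoly_odd P m_ge) !at0E.
- by rewrite /even_rec /psi_at0 -!at0M (divpoly_even P m_ge) !at0E.
Qed.

Lemma psi_at0_0 : psi_at0 0 = 0.
Proof. by rewrite /psi_at0 (divpoly0 (psiP W)) /at0 !horner0. Qed.

Lemma psi_at0_1 : psi_at0 1 = 1.
Proof. by rewrite /psi_at0 (divpoly1 (psiP W)) /at0 !hornerC. Qed.

Lemma psi_at0_2 : psi_at0 2 = a3 W.
Proof. by rewrite /psi_at0 (divpoly2 (psiP W)) /psi2 !at0E. Qed.

Lemma psi_at0_3 : psi_at0 3 = b8 W.
Proof. by rewrite /psi_at0 (divpoly3 (psiP W)) /psi3 !at0E. Qed.

Lemma psi_at0_4 : psi_at0 4 = a3 W * (b4 W * b8 W - b6 W ^+ 2).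
Proof. by rewrite /psi_at0 (divpoly4 (psiP W)) /psi4_cofactor /psi2 !at0E. Qed.

Lemma G0 : G W 0 = 1. Proof. by rewrite /G !hornerE. Qed.

(** [phi n = x psi_n^2 - psi_(n+1) psi_(n-1)], and [x = 0] at the origin. *)
Lemma G_psi_at0 n : G W n.+1 = - (psi_at0 n.+2 * psi_at0 n).
Proof.
case: n => [|n].
  by rewrite psi_at0_0 mulr0 oppr0 -[G W 1]/(at0 varx) at0_varx.
rewrite -[G W n.+2]/(at0 (phi W n.+2)) /phi !at0E mul0r add0r.
by rewrite addn1 subn1.
Qed.

(** * Numerators on a curve with a table *)

Section TorsionTable.

Variables (T : torsion_table) (p : seq int).
Local Notation A := (ratio T).
Local Notation B := (step T).
Local Notation N := (size (terms T)).

(** [G r], read off the table. *)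
Definition gterm (r : nat) : monomial :=
  if r is r'.+1 then mopp (mmul (mterm T r.+1) (mterm T r')) else mone.

(** The conditions on a table that only concern exponents and signs.  That
    [gterm N] is [A^N] makes [G] quasi-periodic at [0] too, where [G] is not
    minus a product of two terms.  A negative [A] is admitted for even [N]
    only, because [k (2 r + N k)] is even then and the sign disappears from the
    closed form. *)
Definition consistent_table : bool :=
  [&& (1 < N)%N, mterm T 0 == None, mterm T 1 == mone,
      mexp A N == mexp B 2,
      gterm N == mexp A N &
      if A is Some (sA, _) then ~~ (sA && odd N) else false].

Hypothesis W4 : a4 W = 0.
Hypothesis W6 : a6 W = 0.
Hypothesis a3_neq0 : a3 W != 0.
Hypothesis tableP : consistent_table.
Hypothesis relsP : all_hold p (reduced_relations T).
Hypothesis term2 : mval p (mterm T 2) = a3 W.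
Hypothesis term3 : mval p (mterm T 3) = a2 W * a3 W ^+ 2.
Hypothesis term4 : mval p (mterm T 4) = a3 W ^+ 4 * (a1 W * a2 W - a3 W).

Lemma psi_at0_table : psi_at0 =1 (fun n => mval p (mterm T n)).
Proof.
case/and5P: tableP => N1 /eqP c0 /eqP c1 /eqP AB _.
apply: elliptic_rec_unique.
- by apply: mterm_elliptic => //; apply: ltnW.
- exact: psi_at0_elliptic.
- by rewrite psi_at0_2.
case=> [|[|[|[|[|//]]]]] _.
- by rewrite c0 psi_at0_0.
- by rewrite c1 psi_at0_1 mval1.
- by rewrite term2 psi_at0_2.
- by rewrite term3 psi_at0_3 /b8 W4 W6; ring.
- by rewrite term4 psi_at0_4 /b4 /b6 /b8 W4 W6; ring.
Qed.

Lemma G_gterm n : G W n = mval p (gterm n).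
Proof.
case: n => [|n]; rewrite ?G0 ?mval1 // G_psi_at0 !psi_at0_table /gterm.
by rewrite mvalN mvalM.
Qed.

Lemma G_shift n : G W (n + N) = mval p A ^+ (2 * n + N) * G W n.
Proof.
case/and5P: tableP => N1 _ _ /eqP AB /andP[/eqP GN _].
have ABv : mval p A ^+ N = mval p B ^+ 2 by rewrite -!mvalX AB.
case: n => [|n]; first by rewrite add0n G_gterm GN G0 mulr1 mvalX.
have cN := mterm_shift p (ltnW N1) AB.
rewrite addSn !G_psi_at0 !psi_at0_table -!addSn !cN exprD ABv.
have -> : (2 * n.+1 = n.+2 + n)%N by lia.
by rewrite exprD; ring.
Qed.

(** The exponents [2 n + N] of [G_shift] at [n = r, r + N, ..., r + N (k - 1)]
    add up to [k (2 r + N k)]. *)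
Theorem G_quadratic r k :
  G W (r + N * k) = mval p A ^+ (k * (2 * r + N * k)) * mval p (gterm r).
Proof.
rewrite -G_gterm; elim: k => [|k IH]; first by rewrite muln0 addn0 mul0n mul1r.
rewrite mulnSr addnA G_shift IH mulrA -exprD; congr (_ ^+ _ * _); lia.
Qed.

(** [G_quadratic] with the exponents of each factor collected. *)
Definition gvalue (r k : nat) : int :=
  if (gterm r, A) is (Some (s, e), Some (_, eA)) then
    (-1) ^+ s *
      exp_val p (exp_mul [seq (k * (2 * r + N * k) * i)%N | i <- eA] e)
  else 0.

Theorem G_closed_form r k : G W (r + N * k) = gvalue r k.
Proof.
rewrite G_quadratic /gvalue; case: gterm => [[s e]|]; last by rewrite mulr0.
case/and5P: tableP => _ _ _ _ /andP[_]; case: A => [[sA eA]|] // sN.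
set K := (k * _)%N; rewrite /= exp_valM exprMn exp_valX.
have -> : (-1) ^+ sA ^+ K = 1 :> int.
  case: sA sN => /= sN; last by rewrite expr1n.
  rewrite expr1 -signr_odd /K oddM oddD mul2n odd_double oddM (negbTE sN).
  by rewrite andbF.
by rewrite mul1r mulrCA.
Qed.

End TorsionTable.

End CurveThroughOrigin.

(** * Nonvanishing of the factors *)

(** The values of [eta], [zeta], [theta] and [2 alpha - 1] are odd, and so are
    the factors of [lambda] other than [alpha]; hence none of them is [0]. *)
Lemma parity (a : int) : exists k, a = 2 * k \/ a = 2 * k + 1.
Proof. by exists (a %/ 2)%Z; lia. Qed.

Lemma eta_neq0 a : eta a != 0.
Proof. by rewrite /eta; have [k [->|->]] := parity a; lia. Qed.

Lemma zeta_neq0 a : zeta a != 0.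
Proof. by rewrite /zeta; have [k [->|->]] := parity a; lia. Qed.

Lemma theta_neq0 a : theta a != 0.
Proof. by rewrite /theta; lia. Qed.

Lemma lambda_neq0 a : a != 0 -> lambda a != 0.
Proof.
move=> a0; rewrite /lambda (_ : a - 2 * a ^+ 2 = a * (1 - 2 * a)); last by ring.
rewrite !mulf_eq0 !negb_or a0 /=; have [k [->|->]] := parity a.
  by apply/andP; split; lia.
by apply/andP; split; lia.
Qed.

Lemma double_pred_neq0 (a : int) : 2 * a - 1 != 0.
Proof. by lia. Qed.

(** * The tables *)

(** The exponents refer to the factors [alpha] for [N = 4] and [N = 5];
    [alpha] and [alpha + 1] for [N = 6]; [alpha] and [alpha - 1] for [N = 7];
    these two and [eta] for [N = 9]; these two with [2 alpha - 1] and [zeta]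
    for [N = 10], and with [2 alpha - 1], [lambda] and [theta] for [N = 12].
    For [N = 12] the factors are not coprime, [lambda] being a multiple of
    [alpha] and of [2 alpha - 1]; the exponents of [lambda] are those of its
    third factor [3 alpha^2 - 3 alpha + 1]. *)
Definition E4_table : torsion_table := TorsionTable
    [:: None; mone; Some (true, [:: 1]); Some (true, [:: 3])]%N
    (Some (true, [:: 3]))%N
    (Some (true, [:: 6]))%N.

Definition E5_table : torsion_table := TorsionTable
    [:: None; mone; Some (true, [:: 1]); Some (true, [:: 3]);
        Some (false, [:: 6])]%N
    (Some (false, [:: 4]))%N
    (Some (true, [:: 10]))%N.

Definition E6_table : torsion_table := TorsionTable
    [:: None; mone; Some (true, [:: 1; 1]); Some (true, [:: 3; 3]);
        Some (false, [:: 6; 5]); Some (false, [:: 10; 8])]%N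
    (Some (true, [:: 5; 4]))%N
    (Some (false, [:: 15; 12]))%N.

Definition E7_table : torsion_table := TorsionTable
    [:: None; mone; Some (true, [:: 2; 1]); Some (true, [:: 6; 3]);
        Some (false, [:: 11; 6]); Some (false, [:: 17; 10]);
        Some (true, [:: 25; 15])]%N
    (Some (false, [:: 10; 6]))%N
    (Some (false, [:: 35; 21]))%N.

Definition E9_table : torsion_table := TorsionTable
    [:: None; mone; Some (true, [:: 2; 1; 1]); Some (true, [:: 6; 3; 3]);
        Some (false, [:: 12; 6; 5]); Some (false, [:: 19; 10; 8]);
        Some (true, [:: 27; 15; 12]); Some (true, [:: 37; 21; 16]);
        Some (false, [:: 49; 28; 21])]%N
    (Some (false, [:: 14; 8; 6]))%N
    (Some (true, [:: 63; 36; 27]))%N.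

Definition E10_table : torsion_table := TorsionTable
    [:: None; mone; Some (true, [:: 3; 1; 1; 4]);
        Some (true, [:: 9; 3; 3; 10]); Some (false, [:: 16; 6; 6; 19]);
        Some (false, [:: 25; 10; 10; 30]); Some (true, [:: 37; 15; 14; 44]);
        Some (true, [:: 51; 21; 19; 60]); Some (false, [:: 66; 28; 25; 79]);
        Some (false, [:: 84; 36; 32; 100])]%N
    (Some (true, [:: 21; 9; 8; 25]))%N
    (Some (false, [:: 105; 45; 40; 125]))%N.

Definition E12_table : torsion_table := TorsionTable
    [:: None; mone; Some (true, [:: 0; 8; 0; 1; 1]);
        Some (true, [:: 0; 20; 0; 3; 3]); Some (false, [:: 0; 37; 0; 6; 5]);
        Some (true, [:: 1; 60; 1; 9; 8]); Some (false, [:: 2; 86; 2; 13; 12]);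
        Some (true, [:: 3; 119; 2; 18; 16]);
        Some (false, [:: 4; 155; 2; 24; 21]);
        Some (true, [:: 6; 197; 3; 30; 27]);
        Some (true, [:: 8; 244; 4; 37; 33]);
        Some (false, [:: 10; 295; 5; 45; 40])]%N
    (Some (false, [:: 2; 59; 1; 9; 8]))%N
    (Some (true, [:: 12; 354; 6; 54; 48]))%N.

(** * The closed form on each curve *)

Ltac evaluate x := let v := eval vm_compute in x in
  rewrite (_ : x = v); last by vm_compute.

(** Discharges what the closed form asks of a table: the conditions on the
    exponents by computation, then the identities in [alpha]. *)
Ltac check_table :=
  lazymatch goal with
  | |- is_true (consistent_table _) => by vm_compute
  | |- all_hold _ ?s =>
      evaluate s; rewrite /all_hold /holds /mval /exp_val /=; do ?split
  | |- mval _ ?x = _ => evaluate x; rewrite /mval /exp_val /=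
  end;
  rewrite /eta /zeta /beta /lambda /theta; ring.

Lemma G_E4 alpha : alpha != 0 ->
  forall r k, G (E4 alpha) (r + 4 * k) =
    gvalue E4_table [:: alpha] r k.
Proof.
move=> n0.
refine (@G_closed_form (E4 alpha) E4_table _ erefl erefl _ _ _ _ _ _).
  have -> : a3 (E4 alpha) = - alpha by rewrite /= /eta; ring.
  by rewrite oppr_eq0.
all: by check_table.
Qed.

Lemma G_E5 alpha : alpha != 0 ->
  forall r k, G (E5 alpha) (r + 5 * k) =
    gvalue E5_table [:: alpha] r k.
Proof.
move=> n0.
refine (@G_closed_form (E5 alpha) E5_table _ erefl erefl _ _ _ _ _ _).
  have -> : a3 (E5 alpha) = - alpha by rewrite /= /eta; ring.
  by rewrite oppr_eq0.
all: by check_table.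
Qed.

Lemma G_E6 alpha : alpha != -1 -> alpha != 0 ->
  forall r k, G (E6 alpha) (r + 6 * k) =
    gvalue E6_table [:: alpha; alpha + 1] r k.
Proof.
move=> n1 n0.
refine (@G_closed_form (E6 alpha) E6_table _ erefl erefl _ _ _ _ _ _).
  have -> : a3 (E6 alpha) = - (alpha * (alpha + 1)) by rewrite /= /eta; ring.
  by rewrite oppr_eq0 mulf_neq0 // addr_eq0.
all: by check_table.
Qed.

Lemma G_E7 alpha : alpha != 0 -> alpha != 1 ->
  forall r k, G (E7 alpha) (r + 7 * k) =
    gvalue E7_table [:: alpha; alpha - 1] r k.
Proof.
move=> n0 n1.
refine (@G_closed_form (E7 alpha) E7_table _ erefl erefl _ _ _ _ _ _).
  have -> : a3 (E7 alpha) = - (alpha ^+ 2 * (alpha - 1)).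
    by rewrite /= /eta; ring.
  by rewrite oppr_eq0 mulf_neq0 ?expf_neq0 // subr_eq0.
all: by check_table.
Qed.

Lemma G_E9 alpha : alpha != 0 -> alpha != 1 ->
  forall r k, G (E9 alpha) (r + 9 * k) =
    gvalue E9_table [:: alpha; alpha - 1; eta alpha] r k.
Proof.
move=> n0 n1.
refine (@G_closed_form (E9 alpha) E9_table _ erefl erefl _ _ _ _ _ _).
  have -> : a3 (E9 alpha) = - (alpha ^+ 2 * (alpha - 1) * eta alpha).
    by rewrite /= /eta; ring.
  by rewrite oppr_eq0 !mulf_neq0 ?expf_neq0 ?eta_neq0 // subr_eq0.
all: by check_table.
Qed.

Lemma G_E10 alpha : alpha != 0 -> alpha != 1 ->
  forall r k, G (E10 alpha) (r + 10 * k) =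
    gvalue E10_table [:: alpha; alpha - 1; 2 * alpha - 1; zeta alpha] r k.
Proof.
move=> n0 n1.
refine (@G_closed_form (E10 alpha) E10_table _ erefl erefl _ _ _ _ _ _).
  have -> : a3 (E10 alpha) = - (alpha ^+ 3 * beta alpha * zeta alpha ^+ 4).
    by rewrite /= /eta; ring.
  by rewrite oppr_eq0 !mulf_neq0 ?expf_neq0 ?double_pred_neq0 ?zeta_neq0 //
    subr_eq0.
all: by check_table.
Qed.

Lemma G_E12 alpha : alpha != 0 -> alpha != 1 ->
  forall r k, G (E12 alpha) (r + 12 * k) =
    gvalue E12_table
      [:: alpha; alpha - 1; 2 * alpha - 1; lambda alpha; theta alpha]
      r k.
Proof.
move=> n0 n1.
refine (@G_closed_form (E12 alpha) E12_table _ erefl erefl _ _ _ _ _ _).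
  have -> : a3 (E12 alpha) = - ((alpha - 1) ^+ 8 * lambda alpha * theta alpha).
    by rewrite /= /eta; ring.
  by rewrite oppr_eq0 mulf_neq0 ?theta_neq0 // mulf_neq0 ?lambda_neq0 //
    expf_neq0 // subr_eq0.
all: by check_table.
Qed.

(** * The exponents *)

Lemma residue (N n : nat) : (0 < N)%N ->
  exists r k, [/\ (r < N)%N, (n %% N)%N = r & n = (r + N * k)%N].
Proof.
move=> N0; exists (n %% N)%N, (n %/ N)%N; rewrite ltn_pmod //; split=> //.
by rewrite addnC mulnC -divn_eq.
Qed.

Ltac evaluate_gvalue :=
  rewrite /gvalue; lazymatch goal with |- context [gterm ?T ?r] =>
    evaluate (gterm T r); rewrite /= end.

(** The exponents of the closed form are found by unification with the last
    equation; the quadratic equations for them are left.  Only for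
    [N = 12] does the right-hand side start with an explicit sign factor;
    [sign] removes the factor [1] in the other cases. *)
Ltac closed_form sign :=
  lazymatch goal with
  | |- exists _, _ => eexists; closed_form sign
  | |- and3 _ _ _ => split; [| | closed_form sign]
  | |- and4 _ _ _ _ => split; [| | | closed_form sign]
  | |- and5 _ _ _ _ _ => split; [| | | | closed_form sign]
  | |- _ /\ _ => split; [| closed_form sign]
  | |- _ = 0 => evaluate_gvalue; reflexivity
  | |- _ => evaluate_gvalue; rewrite ?expr0 ?expr1 mulr1; sign; rewrite ?mulrA;
            reflexivity
  end.

Theorem theoremA1 (alpha : int) (n : nat) :
  (* N = 4 *)
  (alpha != 0 ->
    if odd n then G (E4 alpha) n = 0
    else exists e : nat,
      e%:Z * 4 = 3 * n%:Z ^+ 2 /\ G (E4 alpha) n = alpha ^+ e)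
  /\ (* N = 5 *)
  (alpha != 0 ->
    let r := (n %% 5)%N in
    if r \in [:: 1; 4]%N then G (E5 alpha) n = 0
    else
      let a : int := if r \in [:: 2; 3]%N then 1 else 0 in
      exists e : nat,
        e%:Z * 5 = 4 * n%:Z ^+ 2 - a /\ G (E5 alpha) n = alpha ^+ e)
  /\ (* N = 6 *)
  (alpha != -1 -> alpha != 0 ->
    let r := (n %% 6)%N in
    if r \in [:: 1; 5]%N then G (E6 alpha) n = 0
    else
      let a : int :=
        if r \in [:: 2; 4]%N then 2 else if r == 3%N then 3 else 0 in
      let b : int := if r \in [:: 2; 4]%N then 1 else 0 in
      exists e1 e2 : nat,
        [/\ e1%:Z * 6 = 5 * n%:Z ^+ 2 - a,
            e2%:Z * 3 = 2 * n%:Z ^+ 2 + b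
          & G (E6 alpha) n = alpha ^+ e1 * (alpha + 1) ^+ e2])
  /\ (* N = 7 *)
  (alpha != 0 -> alpha != 1 ->
    let r := (n %% 7)%N in
    if r \in [:: 1; 6]%N then G (E7 alpha) n = 0
    else
      let a : int :=
        if r \in [:: 2; 5]%N then 2 else if r \in [:: 3; 4]%N then 1 else 0 in
      let b : int :=
        if r \in [:: 2; 5]%N then 3 else if r \in [:: 3; 4]%N then 5 else 0 in
      exists e1 e2 : nat,
        [/\ e1%:Z * 7 = 10 * n%:Z ^+ 2 + a,
            e2%:Z * 7 = 6 * n%:Z ^+ 2 - b
          & G (E7 alpha) n = alpha ^+ e1 * (alpha - 1) ^+ e2])
  /\ (* N = 9 *)
  (alpha != 0 -> alpha != 1 ->
    let r := (n %% 9)%N in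
    if r \in [:: 1; 8]%N then G (E9 alpha) n = 0
    else
      let a : int :=
        if r \in [:: 2; 7]%N then 2 else if r \in [:: 4; 5]%N then -1 else 0 in
      let b : int :=
        if r \in [:: 2; 7]%N then 5
        else if r \in [:: 3; 6]%N then 9
        else if r \in [:: 4; 5]%N then 11 else 0 in
      let c : int := if r \in [:: 2; 4; 5; 7]%N then 1 else 0 in
      exists e1 e2 e3 : nat,
        [/\ e1%:Z * 9 = 14 * n%:Z ^+ 2 - a,
            e2%:Z * 9 = 8 * n%:Z ^+ 2 - b,
            e3%:Z * 3 = 2 * n%:Z ^+ 2 + c
          & G (E9 alpha) n = alpha ^+ e1 * (alpha - 1) ^+ e2 * eta alpha ^+ e3])
  /\ (* N = 10 *)
  (alpha != 0 -> alpha != 1 ->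
    let r := (n %% 10)%N in
    if r \in [:: 1; 9]%N then G (E10 alpha) n = 0
    else
      let a : int :=
        if r \in [:: 2; 8]%N then 6
        else if r \in [:: 3; 7]%N then 1
        else if r \in [:: 4; 6]%N then 4
        else if r == 5%N then 5 else 0 in
      let b : int :=
        if r \in [:: 2; 8]%N then 6
        else if r \in [:: 3; 7]%N then 11
        else if r \in [:: 4; 6]%N then 14
        else if r == 5%N then 15 else 0 in
      let c : int :=
        if r \in [:: 2; 3; 7; 8]%N then 1
        else if r \in [:: 4; 6]%N then -1 else 0 in
      let d : int := if r \in [:: 3; 5; 7]%N then 1 else 0 in
      exists e1 e2 e3 e4 : nat,
        [/\ e1%:Z * 10 = 21 * n%:Z ^+ 2 + a,
            e2%:Z * 10 = 9 * n%:Z ^+ 2 - b,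
            e3%:Z * 5 = 4 * n%:Z ^+ 2 - c,
            e4%:Z * 2 = 5 * n%:Z ^+ 2 + d
          & G (E10 alpha) n =
              alpha ^+ e1 * (alpha - 1) ^+ e2 * (2 * alpha - 1) ^+ e3
              * zeta alpha ^+ e4])
  /\ (* N = 12 *)
  (alpha != 0 -> alpha != 1 ->
    let r := (n %% 12)%N in
    if r \in [:: 1; 11]%N then G (E12 alpha) n = 0
    else
      let epsilon : int := if r \in [:: 4; 5; 6; 7; 8]%N then -1 else 1 in
      let a : int :=
        if r \in [:: 2; 10]%N then 4
        else if r \in [:: 3; 9]%N then 9
        else if r \in [:: 4; 8]%N then 10
        else if r \in [:: 5; 7]%N then 13
        else if r == 6%N then 12 else 0 in
      let b : int :=
        if r \in [:: 2; 10]%N then 4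
        else if r \in [:: 3; 9]%N then 9
        else if r \in [:: 4; 8]%N then 16
        else if r \in [:: 5; 7]%N then 1
        else if r == 6%N then 24 else 0 in
      let c : int :=
        if r \in [:: 2; 4; 8; 10]%N then 4
        else if r \in [:: 3; 9]%N then 9
        else if r \in [:: 5; 7]%N then 1 else 0 in
      let d : int := if r \in [:: 3; 5; 7; 9]%N then 1 else 0 in
      let e : int := if r \in [:: 2; 4; 5; 7; 8; 10]%N then 1 else 0 in
      exists e1 e2 e3 e4 e5 : nat,
        e1%:Z * 6 = n%:Z ^+ 2 - a /\
        e2%:Z * 12 = 59 * n%:Z ^+ 2 + b /\
        e3%:Z * 12 = n%:Z ^+ 2 - c /\
        e4%:Z * 4 = 3 * n%:Z ^+ 2 + d /\
        e5%:Z * 3 = 2 * n%:Z ^+ 2 + e /\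
        G (E12 alpha) n =
          epsilon * alpha ^+ e1 * (alpha - 1) ^+ e2 * (2 * alpha - 1) ^+ e3
          * lambda alpha ^+ e4 * theta alpha ^+ e5).
Proof.
split; [|split; [|split; [|split; [|split; [|split]]]]].
- move=> n0; have [r [k [rN _ ->]]] := @residue 4 n isT.
  rewrite G_E4 // oddD oddM andFb addbF.
  case: r rN => [|[|[|[|//]]]] _ /=;
    closed_form ltac:(rewrite mul1r); lia.
- move=> n0; have [r [k [rN -> ->]]] := @residue 5 n isT.
  rewrite G_E5 //.
  case: r rN => [|[|[|[|[|//]]]]] _ /=;
    closed_form ltac:(rewrite mul1r); lia.
- move=> n1 n0; have [r [k [rN -> ->]]] := @residue 6 n isT.
  rewrite G_E6 //.
  case: r rN => [|[|[|[|[|[|//]]]]]] _ /=;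
    closed_form ltac:(rewrite mul1r); lia.
- move=> n0 n1; have [r [k [rN -> ->]]] := @residue 7 n isT.
  rewrite G_E7 //.
  case: r rN => [|[|[|[|[|[|[|//]]]]]]] _ /=;
    closed_form ltac:(rewrite mul1r); lia.
- move=> n0 n1; have [r [k [rN -> ->]]] := @residue 9 n isT.
  rewrite G_E9 //.
  case: r rN => [|[|[|[|[|[|[|[|[|//]]]]]]]]] _ /=;
    closed_form ltac:(rewrite mul1r); lia.
- move=> n0 n1; have [r [k [rN -> ->]]] := @residue 10 n isT.
  rewrite G_E10 //.
  case: r rN => [|[|[|[|[|[|[|[|[|[|//]]]]]]]]]] _ /=;
    closed_form ltac:(rewrite mul1r); lia.
- move=> n0 n1; have [r [k [rN -> ->]]] := @residue 12 n isT.
  rewrite G_E12 //.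
  case: r rN => [|[|[|[|[|[|[|[|[|[|[|[|//]]]]]]]]]]]] _ /=;
    closed_form ltac:(idtac); lia.
Qed.
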